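(* Let $d\ge2$ and suppose that $t>\frac1{\mu_d}$. Define $\zeta_d=\log\frac{\mu_d}{\mu_{d-1}}$ (with $\mu_1=1$). For $N\ge1$ let $G_N(a,t)=\sum_{n=0}^N A_n^+(a)t^n$, regarded as a polynomial of degree $N$ in $a$, and for $\rho\in(0,1)$ let $\nu_N(\rho)$ be the number of its $a$-plane zeros (Yang-Lee zeros, with multiplicity) in the annulus $1-\rho\le|a|\le\frac1{1-\rho}$. If $\zeta_d<\rho<1$, then \[ 0<1-\frac1\rho\zeta_d\le\liminf_{N\to\infty}\frac1N\nu_N(\rho)\le\limsup_{N\to\infty}\frac1N\nu_N(\rho)\le1, \] and a positive fraction of Yang-Lee zeros of $G_N(a,t)$ are in the annulus $1-\rho<|a|<\frac1{1-\rho}$ in the complex $a$-plane.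
   Context: Let $\mathbb{L}^d_+$ be the half-lattice of the $d$-dimensional hypercubic lattice (vertices with last coordinate $\ge0$). A positive walk is a self-avoiding walk in $\mathbb{L}^d_+$ starting at the origin; its visits are its vertices other than the origin with last coordinate $0$. $c_n^+(v)$ is the number of positive walks of length $n$ with $v$ visits and $A_n^+(a)=\sum_{v=0}^n c_n^+(v)a^v$. $\mu_d$ and $\mu_{d-1}$ are the growth constants of self-avoiding walks in $d$ and $d-1$ dimensions, with the convention $\mu_1=1$. *)

(* Defs.v *)
From HB Require Import structures.
From mathcomp Require Import all_boot all_order all_algebra.
From mathcomp Require Import all_classical all_reals all_analysis.
From mathcomp Require Import complex.

Set Implicit Arguments.
Unset Strict Implicit.
Unset Printing Implicit Defensive.

Import Order.TTheory GRing.Theory Num.Theory.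
Local Open Scope ring_scope.

(* A vertex of Z^d is a list of d integers; coordinate i is [nth 0 v i].
   The last coordinate is coordinate d-1.
   A step is a pair (i, b): move by +1 (b = true) or -1 (b = false)
   along coordinate i. *)

Definition origin (d : nat) : seq int := nseq d 0.

Definition step (d : nat) (v : seq int) (st : 'I_d * bool) : seq int :=
  set_nth 0 v st.1 (nth 0 v st.1 + (if st.2 then 1 else -1)).

(* vertices visited after each step (all vertices except the origin) *)
Definition walk_pts (d : nat) (s : seq ('I_d * bool)) : seq (seq int) :=
  scanl (@step d) (origin d) s.

Definition last_coord (d : nat) (v : seq int) : int := nth 0 v d.-1.

Definition is_saw (d : nat) (s : seq ('I_d * bool)) : bool :=
  uniq (origin d :: walk_pts s).

Definition is_positive_walk (d : nat) (s : seq ('I_d * bool)) : bool :=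
  is_saw s && all (fun v => 0 <= last_coord d v) (walk_pts s).

Definition visits (d : nat) (s : seq ('I_d * bool)) : nat :=
  count (fun v => last_coord d v == 0) (walk_pts s).

Definition c_saw (d n : nat) : nat :=
  #|[set s : n.-tuple ('I_d * bool) | is_saw s]|.

Definition c_plus (d n v : nat) : nat :=
  #|[set s : n.-tuple ('I_d * bool) | is_positive_walk s && (visits s == v)]|.

Unset Implicit Arguments.
Definition mu (R : realType) (d : nat) : R :=
  if d == 1%N then 1
  else limn (fun n : nat => ((c_saw d n)%:R : R) `^ (n%:R^-1)).

Definition zeta (R : realType) (d : nat) : R := ln (mu R d / mu R d.-1).

Local Open Scope complex_scope.

Definition Aplus (R : realType) (d n : nat) : {poly R[i]} :=
  \sum_(v < n.+1) ((c_plus d n v)%:R : R[i]) *: 'X^v.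

Definition G (R : realType) (d N : nat) (t : R) : {poly R[i]} :=
  \sum_(n < N.+1) ((t ^+ n)%:C : R[i]) *: Aplus R d n.

(* the list of complex zeros of p, with multiplicity *)
Definition zeros (R : realType) (p : {poly R[i]}) : seq R[i] :=
  sval (closed_field_poly_normal p).

Definition nu (R : realType) (d N : nat) (t rho : R) : nat :=
  count (fun z : R[i] => ((1 - rho)%:C <= `|z|) && (`|z| <= ((1 - rho)^-1)%:C))
        (zeros R (G R d N t)).

Definition nu_open (R : realType) (d N : nat) (t rho : R) : nat :=
  count (fun z : R[i] => ((1 - rho)%:C < `|z|) && (`|z| < ((1 - rho)^-1)%:C))
        (zeros R (G R d N t)).

(* Main.v *)
Require Import Defs.
From HB Require Import structures.
From mathcomp Require Import all_boot all_order all_algebra.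
From mathcomp Require Import all_classical all_reals all_analysis.
From mathcomp Require Import complex zify ring lra.
Import Order.TTheory GRing.Theory Num.Theory.
Local Open Scope ring_scope.

(* Write [G_N = \sum_v g_v a^v], with all [g_v >= 0].  Reflecting roots in the unit
   circle preserves the l2 norm of the coefficients, hence (Landau) the Mahler
   measure [M = |g_N| \prod max(1, |z|) = |g_0| \prod max(1, 1/|z|)] is at most
   [G_N(1)].  Thus [\prod max(|z|, 1/|z|) = M^2 / (g_N g_0)] is at most
   [G_N(1)^2 / (g_N g_0)], and each zero outside the annulus contributes at least
   [1/(1-rho) >= exp rho] to that product.
   Since [t mu_d > 1], [G_N(1)] grows at most like [(t mu_d)^N].  Walks confined to
   the boundary give [g_N >= (t mu_(d-1))^N].  Finally [g_0] is at least [t^N] times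
   the number of bridges of length [N], and bridges grow like [mu_d^N]: by unfolding
   (Hammersley-Welsh), half-space walks have generating function at most
   [\prod_j (1 + B_j) <= exp B], with [B_j] that of bridges of span [j] and [B] that
   of all bridges, while cutting a walk at its highest point gives two half-space
   walks; so bridges cannot grow more slowly than walks.  Altogether the number of
   zeros outside the annulus is at most [N (zeta_d + o(1)) / rho]. *)

(** * Walks as trajectories *)

Section Trajectories.
Context {d : nat}.
Implicit Types (s : seq ('I_d * bool)) (k : nat) (c : 'I_d).

Definition step_coord (st : 'I_d * bool) c : int :=
  if st.1 == c then (if st.2 then 1 else -1) else 0.

(** A sum of signed steps turns concatenation, cutting and reversal into linear identities. For [k]
    beyond the length, the walk rests at its endpoint. *)
Definition pos s k c : int := \sum_(st <- take k s) step_coord st c.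

Lemma pos0 s c : pos s 0 c = 0.
Proof. by rewrite /pos take0 big_nil. Qed.

Lemma pos_take m s k c : (k <= m)%N -> pos (take m s) k c = pos s k c.
Proof. by move=> km; rewrite /pos take_takel. Qed.

Lemma pos_catl s1 s2 k c : (k <= size s1)%N -> pos (s1 ++ s2) k c = pos s1 k c.
Proof. by move=> k1; rewrite /pos takel_cat. Qed.

Lemma pos_catr s1 s2 k c :
  pos (s1 ++ s2) (size s1 + k) c = pos s1 (size s1) c + pos s2 k c.
Proof. by rewrite /pos takeD take_size_cat // drop_size_cat // take_size big_cat. Qed.

Lemma pos_drop m s k c : (m <= size s)%N ->
  pos (drop m s) k c = pos s (m + k) c - pos s m c.
Proof.
move=> ms; have := pos_catr (take m s) (drop m s) k c.
rewrite cat_take_drop size_takel // => ->.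
by rewrite pos_take // addrAC subrr add0r.
Qed.

(** Reversing the word without inverting its steps traverses the walk backwards and reflects it
    through a point. *)
Lemma pos_rev s k c : (k <= size s)%N ->
  pos (rev s) k c = pos s (size s) c - pos s (size s - k) c.
Proof.
move=> ks; rewrite /pos take_rev take_size.
rewrite -[X in _ = \sum_(st <- X) _ - _](cat_take_drop (size s - k)) big_cat /=.
rewrite addrAC subrr add0r; apply: perm_big.
by rewrite perm_rev.
Qed.

Lemma pos_cons st s k c : pos (st :: s) k.+1 c = step_coord st c + pos s k c.
Proof. by rewrite /pos /= big_cons. Qed.


Lemma pos_bounds s k c : - (k%:Z) <= pos s k c <= k%:Z.
Proof.
elim: s k => [|st s IH] [|k]; rewrite ?pos0 //; first by rewrite /pos big_nil.
rewrite pos_cons; have := IH k; rewrite /step_coord.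
by case: ifP => _; case: (st.2); lia.
Qed.

Definition saw s := forall i j, (i < j <= size s)%N ->
  ~ (forall c, pos s i c = pos s j c).

Lemma nth_foldl_step s v (c : nat) : size v = d -> forall cd : (c < d)%N,
  nth 0 (foldl (@step d) v s) c = nth 0 v c + pos s (size s) (Ordinal cd).
Proof.
move=> + cd; elim: s v => [|st s IH] v vd /=; first by rewrite pos0 addr0.
have vd' : size (step v st) = d.
  by rewrite size_set_nth vd; apply/maxn_idPr.
rewrite IH // pos_cons addrA; congr (_ + _).
rewrite nth_set_nth /= /step_coord -val_eqE /= eq_sym.
by case: eqP => [->|_] //; rewrite addr0.
Qed.

Lemma size_foldl_step s v : size v = d -> size (foldl (@step d) v s) = d.
Proof.
elim: s v => [|st s IH] v vd //=; apply: IH.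
by rewrite size_set_nth vd; apply/maxn_idPr.
Qed.

Definition vertex s k : seq int := foldl (@step d) (origin d) (take k s).

Lemma size_vertex s k : size (vertex s k) = d.
Proof. by rewrite size_foldl_step // size_nseq. Qed.

Lemma nth_vertex s k c : nth 0 (vertex s k) c = pos s k c.
Proof.
rewrite /vertex; have/nth_foldl_step : size (origin d) = d by rewrite size_nseq.
move=> /(_ (take k s) c (ltn_ord c)) ->.
rewrite nth_nseq ltn_ord add0r; have -> : Ordinal (ltn_ord c) = c by exact: val_inj.
by rewrite /pos take_size.
Qed.

Lemma walk_ptsE s :
  walk_pts s = [seq vertex s k | k <- iota 1 (size s)].
Proof.
apply: (@eq_from_nth _ [::]); first by rewrite size_scanl size_map size_iota.
move=> i; rewrite size_scanl => si.
by rewrite nth_scanl // (nth_map 0%N) ?size_iota // nth_iota // add1n.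
Qed.

Lemma origin_walk_ptsE s :
  origin d :: walk_pts s = [seq vertex s k | k <- iota 0 (size s).+1].
Proof. by rewrite walk_ptsE /= /vertex take0. Qed.

Lemma vertex_eqP s i j :
  reflect (forall c, pos s i c = pos s j c) (vertex s i == vertex s j).
Proof.
apply: (iffP eqP) => [e c|e]; first by rewrite -!nth_vertex e.
apply: (@eq_from_nth _ 0); rewrite !size_vertex // => c cd.
by have := e (Ordinal cd); rewrite -!nth_vertex.
Qed.

Lemma is_sawP s : reflect (saw s) (is_saw s).
Proof.
rewrite /is_saw origin_walk_ptsE.
have nthE k : (k <= size s)%N ->
    nth [::] [seq vertex s k | k <- iota 0 (size s).+1] k = vertex s k.
  by move=> ks; rewrite (nth_map 0%N) ?size_iota // nth_iota.
apply: (iffP (uniqP [::])) => [H i j /andP[ij js] e|H i j].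
  have is' : (i <= size s)%N by apply: leq_trans (ltnW ij) js.
  have /= := H i j; rewrite -!topredE /= size_map size_iota !ltnS !nthE //.
  move=> /(_ is' js); move/vertex_eqP/eqP: e => -> /(_ erefl) ji.
  by rewrite ji ltnn in ij.
rewrite -!topredE /= size_map size_iota !ltnS => si sj.
rewrite !nthE // => e; case: (ltngtP i j) => // ij.
  by case: (H i j); [rewrite ij|apply/vertex_eqP/eqP].
by case: (H j i); [rewrite ij|apply/vertex_eqP/eqP].
Qed.

Lemma saw_take m s : saw s -> saw (take m s).
Proof.
move=> ss i j /andP[ij]; rewrite size_take_min leq_min => /andP[jm js] e.
apply: (ss i j) => [|c]; first by rewrite ij.
by have := e c; rewrite !pos_take // (leq_trans (ltnW ij)).
Qed.

Lemma saw_drop m s : (m <= size s)%N -> saw s -> saw (drop m s).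
Proof.
move=> ms ss i j /andP[ij]; rewrite size_drop => js e.
apply: (ss (m + i) (m + j))%N => [|c]; first by lia.
by have := e c; rewrite !pos_drop //; lia.
Qed.

Lemma saw_rev s : saw s -> saw (rev s).
Proof.
move=> ss i j; rewrite size_rev => /andP[ij js] e.
apply: (ss (size s - j) (size s - i))%N => [|c]; first by lia.
by have := e c; rewrite !pos_rev //; lia.
Qed.

(** Two times within one piece are handled by that piece, the junction belonging to both. Times in
    different pieces are separated by coordinate [c]. *)
Lemma saw_cat s1 s2 c : saw s1 -> saw s2 ->
  (forall i j, (i < size s1)%N -> (0 < j <= size s2)%N ->
     pos s1 i c < pos s1 (size s1) c + pos s2 j c) ->
  saw (s1 ++ s2).
Proof.
move=> ss1 ss2 sep i j; rewrite size_cat => /andP[ij js] e.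
have [j1|j1] := leqP j (size s1).
  apply: (ss1 i j) => [|c']; first by lia.
  by have := e c'; rewrite !pos_catl //; lia.
have {j1} [k kE] : exists k, j = (size s1 + k.+1)%N.
  by exists (j - (size s1).+1)%N; lia.
subst j; have [i1|i1] := ltnP i (size s1).
  have := sep i k.+1 i1; have := e c; rewrite pos_catl ?(ltnW i1) // pos_catr => ->.
  by rewrite ltxx => /(_ _)/negP; apply; lia.
have [l lE] : exists l, i = (size s1 + l)%N by exists (i - size s1)%N; lia.
subst i; apply: (ss2 l k.+1) => [|c']; first by lia.
by have := e c'; rewrite !pos_catr; lia.
Qed.

End Trajectories.

(** * Half-space walks and bridges *)

Section HalfSpace.
Context {n : nat}.
Local Notation S := ('I_n.+1 * bool)%type.
Implicit Types (s : seq S) (k A : nat).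

Definition ht s k : int := pos s k ord_max.

Definition flip_step (st : S) : S :=
  (st.1, if st.1 == ord_max then ~~ st.2 else st.2).
Definition reflect_walk s := map flip_step s.

Lemma reflect_walkK : involutive reflect_walk.
Proof.
move=> s; rewrite /reflect_walk -map_comp map_id_in // => -[c b] _.
by rewrite /flip_step /=; case: eqP => //= _; rewrite negbK.
Qed.

Lemma pos_reflect s k c :
  pos (reflect_walk s) k c = if c == ord_max then - pos s k c else pos s k c.
Proof.
rewrite /pos -map_take big_map; case: ifP => [/eqP->|cN].
  rewrite -sumrN; apply: eq_bigr => -[c' b] _; rewrite /step_coord /=.
  by case: eqP => //= _; case: b.
apply: eq_bigr => -[c' b] _; rewrite /step_coord /=.
by case: ifP => // /eqP ->; rewrite cN.
Qed.

Lemma ht_reflect s k : ht (reflect_walk s) k = - ht s k.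
Proof. by rewrite /ht pos_reflect eqxx. Qed.

Lemma saw_reflect s : saw s -> saw (reflect_walk s).
Proof.
move=> ss i j; rewrite size_map => ij e; apply: (ss i j ij) => c.
by have := e c; rewrite !pos_reflect; case: ifP => // _ /oppr_inj.
Qed.

Definition nonneg_walk s := saw s /\ forall k, (k <= size s)%N -> 0 <= ht s k.

Definition strip_walk A s :=
  saw s /\ forall k, (0 < k <= size s)%N -> 0 < ht s k <= A%:Z.

(** Strict at the bottom but weak at the top: this asymmetry makes bridges closed under
    concatenation. The empty walk is included. *)
Definition bridge s :=
  saw s /\ forall k, (0 < k <= size s)%N -> 0 < ht s k <= ht s (size s).

Definition span_bridge A s :=
  [/\ bridge s, (0 < size s)%N & ht s (size s) = A%:Z].

(** Cut at a highest vertex, at time [m]. The two pieces have heights [ht s m - ht s (m - k)] and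
    [ht s m - ht s (m + k)], nonnegative by maximality. *)
Lemma saw_split_at_max s : saw s -> exists s1 s2,
  [/\ nonneg_walk s1, nonneg_walk s2, size s = (size s1 + size s2)%N
    & s = rev s1 ++ reflect_walk s2].
Proof.
move=> ss; have [m ms mM] : exists2 m, (m <= size s)%N &
    forall k, (k <= size s)%N -> ht s k <= ht s m.
  case: (@Order.TotalTheory.arg_maxP _ _ _ (@ord0 (size s)) predT
    (fun k : 'I_(size s).+1 => ht s k) isT) => m _ H.
  exists m; first by rewrite -ltnS.
  by move=> k; rewrite -ltnS => ks; apply: (H (Ordinal ks)).
exists (rev (take m s)), (reflect_walk (drop m s)); split.
- split; first by apply/saw_rev/saw_take.
  move=> k; rewrite size_rev size_takel // => km.
  rewrite /ht pos_rev size_takel // !pos_take ?leq_subr // subr_ge0.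
  by apply: mM; lia.
- split; first by apply/saw_reflect/saw_drop.
  move=> k; rewrite size_map size_drop => km.
  rewrite ht_reflect /ht pos_drop // opprB subr_ge0.
  by apply: mM; lia.
- by rewrite size_rev size_map -size_cat cat_take_drop.
- by rewrite revK reflect_walkK cat_take_drop.
Qed.

Definition up_step : S := (ord_max, true).

Lemma ht_up s k : ht (up_step :: s) k.+1 = 1 + ht s k.
Proof. by rewrite /ht pos_cons /step_coord eqxx. Qed.

Lemma saw_nil : saw ([::] : seq S).
Proof. by move=> i j /=; lia. Qed.

Lemma saw_up : saw [:: up_step].
Proof.
move=> [|i] [|j] //=; last by lia.
move=> _ /(_ ord_max); rewrite pos0 -/(ht _ _) ht_up /ht /pos big_nil; lia.
Qed.

(** The extra step lifts weak positivity to strict positivity, as unfolding requires. The width is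
    the trivial bound of height by length. *)
Lemma strip_walk_up s : nonneg_walk s ->
  strip_walk (size s).+1 (up_step :: s).
Proof.
move=> [ss sh]; split.
  rewrite -cat1s; apply: (saw_cat _ _ ord_max saw_up ss) => -[|i] //= j _.
  move=> /andP[_ /sh]; rewrite /ht pos0 -!/(ht _ _) ht_up.
  by rewrite {2}/ht pos0 /ht; lia.
move=> [|k] //= ks; rewrite ht_up; have := sh k ks.
by have := pos_bounds s k ord_max; rewrite -/(ht _ _); lia.
Qed.

(* Cutting at the last visit to height [A.+1] and reflecting the remainder in
   that height gives a bridge followed by a walk in a strictly thinner strip. *)
Lemma strip_walk_split A s : strip_walk A.+1 s -> ~ strip_walk A s ->
  exists s1 s2, [/\ span_bridge A.+1 s1, strip_walk A s2,
    size s = (size s1 + size s2)%N & s = s1 ++ reflect_walk s2].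
Proof.
move=> [ss sh] nA.
have ex : exists k, (0 < k <= size s)%N && (ht s k == A.+1%:Z).
  apply: contrapT => H; apply: nA; split => // k ks.
  have := sh k ks; have : ht s k <> A.+1%:Z.
    by move=> e; apply: H; exists k; rewrite ks e eqxx.
  by lia.
have ub : forall k, (0 < k <= size s)%N && (ht s k == A.+1%:Z) -> (k <= size s)%N.
  by move=> k; lia.
case: (ex_maxnP ex ub) => m /andP[/andP[m0 ms] /eqP mA] mM.
exists (take m s), (reflect_walk (drop m s)); split.
- split; rewrite ?size_takel //; last by rewrite /ht pos_take.
  split; first exact: saw_take.
  move=> k; rewrite size_takel // => /andP[k0 km].
  by rewrite /ht !pos_take // -!/(ht _ _) mA; apply: sh; lia.
- split; first by apply/saw_reflect/saw_drop.
  move=> k; rewrite size_map size_drop => km.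
  rewrite ht_reflect /ht pos_drop // -!/(ht _ _) mA.
  have /sh : (0 < m + k <= size s)%N by lia.
  have : ht s (m + k) <> A.+1%:Z.
    move=> e; have := mM (m + k)%N; rewrite e eqxx andbT => /(_ _); lia.
  by lia.
- by rewrite size_map -size_cat cat_take_drop.
- by rewrite reflect_walkK cat_take_drop.
Qed.

Lemma bridge_nil : bridge [::].
Proof. by split; [exact: saw_nil|move=> k /=; lia]. Qed.

Lemma bridge_up : bridge [:: up_step].
Proof.
split; first exact: saw_up.
by move=> [|[|k]] //= _; rewrite ht_up /ht pos0.
Qed.

Lemma bridge_cat s1 s2 : bridge s1 -> bridge s2 -> bridge (s1 ++ s2).
Proof.
move=> [ss1 h1] [ss2 h2].
have e1 : 0 <= ht s1 (size s1).
  case: (posnP (size s1)) => [->|s0]; first by rewrite /ht pos0.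
  by have := h1 (size s1); rewrite s0 leqnn => /(_ isT); lia.
have e2 : 0 <= ht s2 (size s2).
  case: (posnP (size s2)) => [->|s0]; first by rewrite /ht pos0.
  by have := h2 (size s2); rewrite s0 leqnn => /(_ isT); lia.
split.
  apply: (saw_cat _ _ ord_max) => // i j i1 /h2 /andP[+ _].
  rewrite -!/(ht _ _); case: i i1 => [|i] i1; first by rewrite {2}/ht pos0; lia.
  have := h1 i.+1; rewrite (ltnW i1) => /(_ isT); lia.
move=> k; rewrite size_cat => /andP[k0 ks].
rewrite /ht pos_catr -!/(ht _ _).
have [k1|k1] := leqP k (size s1).
  by rewrite /ht pos_catl // -!/(ht _ _); have := h1 k; rewrite k0 k1 => /(_ isT); lia.
have [l lE] : exists l, k = (size s1 + l.+1)%N by exists (k - (size s1).+1)%N; lia.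
rewrite lE /ht pos_catr -!/(ht _ _).
have := h2 l.+1 => /(_ _); lia.
Qed.

Lemma last_coord_vertex s k : last_coord n.+1 (vertex s k) = ht s k.
Proof. exact: (nth_vertex s k ord_max). Qed.

Lemma bridge_positive_walk s : bridge s -> is_positive_walk s && (visits s == 0%N).
Proof.
move=> [/is_sawP ss h]; rewrite /is_positive_walk ss /=.
rewrite /visits walk_ptsE -leqn0 leqNgt -has_count -all_predC -all_predI.
rewrite all_map; apply/allP => k; rewrite mem_iota add1n ltnS => /h.
by rewrite /= !last_coord_vertex; lia.
Qed.

End HalfSpace.

(** * Walks confined to the boundary hyperplane *)

Section Embedding.
Context {n : nat}.
Implicit Types (s : seq ('I_n * bool)).

Definition embed_step (st : 'I_n * bool) : 'I_n.+1 * bool :=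
  (widen_ord (leqnSn n) st.1, st.2).

Lemma pos_embed s k c :
  pos (map embed_step s) k (widen_ord (leqnSn n) c) = pos s k c.
Proof.
rewrite /pos -map_take big_map; apply: eq_bigr => -[c' b] _.
by rewrite /step_coord /= -!val_eqE.
Qed.

Lemma ht_embed s k : ht (map embed_step s) k = 0.
Proof.
rewrite /ht /pos -map_take big_map big1 // => -[c b] _.
by rewrite /step_coord /= -val_eqE /= ltn_eqF.
Qed.

Lemma saw_embed s : saw s -> saw (map embed_step s).
Proof.
move=> ss i j; rewrite size_map => ij e; apply: (ss i j ij) => c.
by have := e (widen_ord (leqnSn n) c); rewrite !pos_embed.
Qed.

Lemma embed_positive_walk s : saw s ->
  is_positive_walk (map embed_step s) && (visits (map embed_step s) == size s).
Proof.
move=> /saw_embed/is_sawP ss; rewrite /is_positive_walk ss /= /visits walk_ptsE.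
rewrite size_map count_map; apply/andP; split.
  by rewrite all_map; apply/allP => k _ /=; rewrite last_coord_vertex ht_embed.
rewrite -[X in _ == X](size_iota 1 (size s)) -all_count.
by apply/allP => k _ /=; rewrite last_coord_vertex ht_embed.
Qed.

End Embedding.

Lemma embed_step_inj n : injective (@embed_step n).
Proof. by move=> [c b] [c' b'] [/val_inj -> ->]. Qed.

(** * Counting words *)

Section Counting.
Context {S : finType}.
Implicit Types (P Q : pred (seq S)) (n N : nat).

Definition nwords P n : nat := #|[set s : n.-tuple S | P s]|.

Lemma nwords_le P Q n : (forall s, size s = n -> P s -> Q s) ->
  (nwords P n <= nwords Q n)%N.
Proof.
move=> PQ; apply/subset_leq_card/fintype.subsetP => s; rewrite !inE.
by apply: PQ; rewrite size_tuple.
Qed.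

Lemma nwords_cat P Q1 Q2 m n :
  (forall s1 s2, size s1 = m -> size s2 = n -> Q1 s1 -> Q2 s2 -> P (s1 ++ s2)) ->
  (nwords Q1 m * nwords Q2 n <= nwords P (m + n))%N.
Proof.
move=> H; rewrite /nwords -cardsX.
rewrite -(@card_in_imset _ _ (fun p : m.-tuple S * n.-tuple S => [tuple of p.1 ++ p.2])).
  apply/subset_leq_card/fintype.subsetP => _ /imsetP[[s1 s2] /[!inE]/= /andP[q1 q2] ->].
  by apply: H; rewrite ?size_tuple.
move=> [s1 s2] [s1' s2'] _ _ /(congr1 val)/eqP /=.
rewrite eqseq_cat ?size_tuple // => /andP[/eqP e1 /eqP e2].
by congr pair; apply: val_inj.
Qed.

Lemma nwords_split P Q1 Q2 m n :
  (forall s, size s = (m + n)%N -> P s -> Q1 (take m s) /\ Q2 (drop m s)) ->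
  (nwords P (m + n) <= nwords Q1 m * nwords Q2 n)%N.
Proof.
move=> H; rewrite /nwords -cardsX.
have tm (s : (m + n).-tuple S) : size (take m s) == m.
  by rewrite size_takel ?size_tuple ?leq_addr.
have dm (s : (m + n).-tuple S) : size (drop m s) == n.
  by rewrite size_drop size_tuple addKn.
rewrite -(@card_in_imset _ _ (fun s => (Tuple (tm s), Tuple (dm s)))).
  apply/subset_leq_card/fintype.subsetP => _ /imsetP[s /[!inE]/= ps ->].
  by have := H s; rewrite size_tuple => /(_ erefl ps)[-> ->].
move=> s s' _ _ [e1 e2]; apply: val_inj => /=.
by rewrite -(cat_take_drop m s) e1 e2 cat_take_drop.
Qed.

Context {R : realFieldType}.

(** The generating function of [P] truncated at length [N]: a finite sum, so no convergence question
    arises. *)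
Definition wgt N (z : R) P : R := \sum_(s : N.-bseq S | P s) z ^+ size s.

(** Each [i] is charged to one preimage under [h]. Fibres are disjoint and the other terms are
    nonnegative. *)
Lemma ler_sum_surj (I J : finType) (P : pred I) (Q : pred J) (F : I -> R) (E : J -> R)
    (h : J -> I) : (forall j, Q j -> 0 <= E j) ->
  (forall i, P i -> exists j, [/\ Q j, h j = i & F i <= E j]) ->
  \sum_(i | P i) F i <= \sum_(j | Q j) E j.
Proof.
move=> E0 H; rewrite (partition_big h predT) //=.
rewrite [leRHS](bigID P) /= -[leLHS]addr0 lerD //; last first.
  by apply: sumr_ge0 => i _; apply: sumr_ge0 => j /andP[/E0].
apply: ler_sum => i /H[j [qj hj FE]].
rewrite (bigD1 j) /=; last by rewrite qj hj eqxx.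
by rewrite -[leLHS]addr0 lerD // sumr_ge0 // => k /andP[/andP[/E0]].
Qed.

Lemma wgt_ge0 N z P : 0 <= z -> 0 <= wgt N z P.
Proof. by move=> z0; apply: sumr_ge0 => s _; rewrite exprn_ge0. Qed.

Lemma val_insub_bseq N (s : seq S) : (size s <= N)%N -> insub_bseq N s = s :> seq S.
Proof. by move=> sN; rewrite /insub_bseq insubdK. Qed.

(** Lengths add, so weights multiply, and neither piece exceeds the truncation. Since [h] recovers
    the word from its pieces, distinct words use distinct pairs. *)
Lemma wgt_split N z P Q1 Q2 (h : seq S -> seq S -> seq S) : 0 <= z ->
  (forall s, (size s <= N)%N -> P s -> exists s1 s2,
     [/\ Q1 s1, Q2 s2, size s = (size s1 + size s2)%N & s = h s1 s2]) ->
  wgt N z P <= wgt N z Q1 * wgt N z Q2.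
Proof.
move=> z0 H; rewrite /wgt big_distrlr /= pair_big.
apply: (ler_sum_surj _ _ _ _ _ _
  (fun p : _.-bseq S * _.-bseq S => insub_bseq N (h p.1 p.2))) => [p _|s ps].
  by rewrite mulr_ge0 // exprn_ge0.
have [s1 [s2 [q1 q2 sE e]]] := H s (size_bseq s) ps.
have sN := size_bseq s.
exists (insub_bseq N s1, insub_bseq N s2) => /=.
rewrite !val_insub_bseq; [|by lia..].
split; [by rewrite q1 q2 | | by rewrite -exprD sE].
by apply: val_inj => /=; rewrite val_insub_bseq -e.
Qed.

Lemma wgtE N z P : wgt N z P = \sum_(n < N.+1) (nwords P n)%:R * z ^+ n.
Proof.
rewrite /wgt (partition_big (fun s : N.-bseq S => inord (size s) : 'I_N.+1) predT) //=.
apply: eq_bigr => n _; have nN : (n <= N)%N by rewrite -ltnS.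
under eq_bigl => s do rewrite -val_eqE /= inordK ?ltnS ?size_bseq //.
under eq_bigr => s /andP[_ /eqP->] do over.
rewrite sumr_const mulr_natl; congr (_ *+ _).
pose f (s : n.-tuple S) : N.-bseq S := widen_bseq nN s.
rewrite /nwords -(card_imset (f := f)); last by move=> s s' /(congr1 val)/= /val_inj.
apply: eq_card => s; apply/andP/imsetP.
  move=> [ps sn]; exists (Tuple sn); first by rewrite inE.
  exact: val_inj.
by move=> [s' /[!inE] ps' ->] /=; rewrite size_tuple.
Qed.

Lemma wgt_ge N z P n : 0 <= z -> (n <= N)%N -> (nwords P n)%:R * z ^+ n <= wgt N z P.
Proof.
move=> z0 nN; rewrite wgtE (bigD1 (inord n)) //= inordK // lerDl.
by apply: sumr_ge0 => i _; rewrite mulr_ge0 // exprn_ge0.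
Qed.

End Counting.

(** * Growth constants *)

Section RealPowers.
Context {R : realType}.
Implicit Types (x K a b : R).

Lemma expr_unbounded x K : 1 < x -> exists n0, forall n, (n0 <= n)%N -> K < x ^+ n.
Proof.
(* Bernoulli's inequality reduces the claim to the Archimedean property. *)
move=> x1; have bern n : 1 + n%:R * (x - 1) <= x ^+ n.
  elim: n => [|n IH]; first by rewrite mul0r addr0 expr0.
  rewrite exprS; apply: le_trans (_ : x * (1 + n%:R * (x - 1)) <= _); last first.
    by rewrite ler_wpM2l //; lra.
  rewrite -natr1 -subr_ge0.
  have -> : x * (1 + n%:R * (x - 1)) - (1 + (n%:R + 1) * (x - 1)) =
    n%:R * (x - 1) ^+ 2 by ring.
  by rewrite mulr_ge0 // sqr_ge0.
exists (Num.bound `|K / (x - 1)|) => n n0.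
apply: lt_le_trans (bern n).
have : K / (x - 1) < n%:R.
  apply: le_lt_trans (ler_norm _) _.
  apply: lt_le_trans (archi_boundP (normr_ge0 _)) _.
  by rewrite ler_nat.
by rewrite ltr_pdivrMr; lra.
Qed.

Lemma expr_dominates a b K : 0 < b -> b < a ->
  exists n0, forall n, (n0 <= n)%N -> K * b ^+ n < a ^+ n.
Proof.
move=> b0 ba; have [|n0 H] := expr_unbounded (a / b) K.
  by rewrite ltr_pdivlMr // mul1r.
exists n0 => n /H; rewrite expr_div_n ltr_pdivlMr //.
by rewrite exprn_gt0.
Qed.

Lemma rootK n b : (0 < n)%N -> 0 <= b -> (b `^ n%:R^-1) ^+ n = b.
Proof.
move=> n0 b0; rewrite -powR_mulrn ?powR_ge0 // -powRrM mulVf ?powRr1 //.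
by rewrite pnatr_eq0 -lt0n.
Qed.

Lemma root_geP n a b : (0 < n)%N -> 0 <= a -> 0 <= b ->
  (a <= b `^ n%:R^-1) = (a ^+ n <= b).
Proof.
by move=> n0 a0 b0; rewrite -(ler_pXn2r n0) ?nnegrE ?powR_ge0 // rootK.
Qed.

Lemma root_leP n a b : (0 < n)%N -> 0 <= a -> 0 <= b ->
  (b `^ n%:R^-1 <= a) = (b <= a ^+ n).
Proof.
by move=> n0 a0 b0; rewrite -(ler_pXn2r n0) ?nnegrE ?powR_ge0 // rootK.
Qed.

End RealPowers.

(** * Fekete's lemma for submultiplicative sequences *)

Section Fekete.
Context {R : realType}.
Variables (c : nat -> R).
Hypothesis c1 : forall n, 1 <= c n.
Hypothesis cD : forall m n, c (m + n) <= c m * c n.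
Local Open Scope classical_set_scope.

Let roots := [set c n `^ n%:R^-1 | n in [set n | (0 < n)%N]].
Let L := inf roots.

Let root1 n : (0 < n)%N -> 1 <= c n `^ n%:R^-1.
Proof. by move=> n0; rewrite root_geP ?expr1n // (le_trans ler01). Qed.

Let has_inf_roots : has_inf roots.
Proof.
split; first by exists (c 1 `^ 1%:R^-1), 1%N.
by exists 1 => _ [n n0 <-]; apply: root1.
Qed.

Let L1 : 1 <= L.
Proof.
by apply: lb_le_inf; [case: has_inf_roots|move=> _ [n n0 <-]; exact: root1].
Qed.

Let c0 n : 0 <= c n. Proof. exact: le_trans (c1 n). Qed.

Let L_le n : (0 < n)%N -> L <= c n `^ n%:R^-1.
Proof. by move=> n0; apply: ge_inf; [case: has_inf_roots|exists n]. Qed.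

Let c_mul m q r : c (q * m + r)%N <= c m ^+ q * c r.
Proof.
elim: q => [|q IH]; first by rewrite mul0n add0n expr0 mul1r.
rewrite mulSn -addnA exprS -mulrA.
by apply: le_trans (cD _ _) _; rewrite ler_wpM2l.
Qed.

(** Choose [m] whose root is within [e] of the infimum and write [n = q * m + r]. The constant [K],
    a sum over all residues, absorbs the factor [c r]. *)
Let c_ub e : 0 < e -> exists2 K, 0 < K & forall n, c n <= K * (L + e) ^+ n.
Proof.
move=> e0; have [_ [m m0 <-]] := inf_adherent e0 has_inf_roots.
rewrite -/L => /ltW; have Le : 1 <= L + e by have := L1; lra.
have Le0 : 0 <= L + e by lra.
rewrite root_leP // => cm.
exists (\sum_(r < m) c r) => [|n].
  rewrite (bigD1 (Ordinal m0)) //= ltr_pwDl ?(lt_le_trans _ (c1 _)) //.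
  by apply: sumr_ge0.
rewrite {1}(divn_eq n m); apply: le_trans (c_mul _ _ _) _.
rewrite mulrC; apply: ler_pM; rewrite ?exprn_ge0 //.
  rewrite (bigD1 (Ordinal (ltn_pmod n m0))) //= lerDl.
  by apply: sumr_ge0.
apply: le_trans (_ : ((L + e) ^+ m) ^+ (n %/ m) <= _).
  by rewrite lerXn2r ?nnegrE ?exprn_ge0.
by rewrite -exprM ler_weXn2l // mulnC leq_divM.
Qed.

Let c_cvg : (fun n => c n `^ n%:R^-1) @ \oo --> L.
Proof.
apply/cvgrPdist_le => e e0.
(* Half of [e] is kept back so that the larger base eventually absorbs [K]. *)
have [|K K0 cK] := c_ub (e / 2); first by lra.
have L1' := L1.
have [||n0 H] := expr_dominates (L + e) (L + e / 2) K; [by lra..|].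
exists (maxn n0 1) => // n /=; rewrite geq_max => /andP[n0n n1].
rewrite distrC ger0_norm ?subr_ge0 ?L_le // lerBlDl root_leP //; last by lra.
by apply: le_trans (cK n) _; apply/ltW/H.
Qed.

(** The limit is the infimum of the roots, so the lower bound carries neither constant nor error
    term. *)
Lemma fekete_submul (l := limn (fun n => c n `^ n%:R^-1)) :
  [/\ 1 <= l, forall n, l ^+ n <= c n &
   forall e, 0 < e -> exists2 K, 0 < K & forall n, c n <= K * (l + e) ^+ n].
Proof.
rewrite /l (cvg_lim _ c_cvg) //; split => // -[|n]; first by rewrite expr0.
by rewrite -root_geP ?L_le // (le_trans ler01).
Qed.

End Fekete.

(** * Growth of self-avoiding walks and of bridges *)

Section GrowthConstant.
Context (R : realType).

Lemma c_saw_submul d m n : (c_saw d (m + n) <= c_saw d m * c_saw d n)%N.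
Proof.
apply: (nwords_split (fun s => is_saw s)) => s sz /is_sawP ss.
split; apply/is_sawP; first exact: saw_take.
by apply: saw_drop => //; rewrite sz leq_addr.
Qed.

(** The index is shifted: these bridges live in dimension [d.+1]. *)
Definition nbridges d k : nat := nwords (fun s => `[< @bridge d s >]) k.

Lemma nbridges_supermul d m k : (nbridges d m * nbridges d k <= nbridges d (m + k))%N.
Proof.
apply: nwords_cat => s1 s2 _ _ /asboolP b1 /asboolP b2.
by apply/asboolP/bridge_cat.
Qed.

Lemma nbridges_gt0 d k : (0 < nbridges d k)%N.
Proof.
elim: k => [|k IH].
  by apply/card_gt0P; exists [tuple]; rewrite inE; apply/asboolP; exact: bridge_nil.
rewrite -(add1n k); apply: leq_trans (nbridges_supermul _ _ _); rewrite muln_gt0 IH andbT.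
apply/card_gt0P; exists [tuple up_step]; rewrite inE; apply/asboolP.
exact: bridge_up.
Qed.

Lemma nbridges_le_c_plus d k : (nbridges d k <= c_plus d.+1 k 0)%N.
Proof.
apply: (nwords_le _ (fun s => is_positive_walk s && (visits s == 0%N))) => s _.
by move=> /asboolP/bridge_positive_walk.
Qed.

(** Walks are sorted by their number of visits, which cannot exceed the length. *)
Lemma sum_c_plus_le_c_saw d k : (\sum_(v < k.+1) c_plus d k v <= c_saw d k)%N.
Proof.
rewrite /c_saw -sum1_card.
have vis (s : k.-tuple ('I_d * bool)) : (visits s < k.+1)%N.
  by rewrite ltnS /visits (leq_trans (count_size _ _)) // size_scanl size_tuple.
rewrite (partition_big (fun s => Ordinal (vis s)) predT) //=.
apply: leq_sum => v _; rewrite sum1_card.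
apply/subset_leq_card/fintype.subsetP => s; rewrite !inE => /andP[/andP[ss _] sv].
by rewrite unfold_in /= inE ss -val_eqE.
Qed.

Lemma c_plus_le_c_saw d k v : (v <= k)%N -> (c_plus d k v <= c_saw d k)%N.
Proof.
rewrite -ltnS => vk; apply: leq_trans (sum_c_plus_le_c_saw d k).
by rewrite (bigD1 (Ordinal vk)) //= leq_addr.
Qed.

Lemma c_saw_le_c_plus_all_visits d k : (c_saw d k <= c_plus d.+1 k k)%N.
Proof.
rewrite /c_saw /c_plus.
pose f (s : k.-tuple ('I_d * bool)) := map_tuple (@embed_step d) s.
rewrite -(card_imset (f := f)); last first.
  by move=> s s' /(congr1 val) /(inj_map (embed_step_inj d))/val_inj.
apply/subset_leq_card/fintype.subsetP => _ /imsetP[s /[!inE] /is_sawP ss ->].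
by have := embed_positive_walk s ss; rewrite size_tuple.
Qed.

Lemma c_saw_gt0 d k : (0 < c_saw d.+1 k)%N.
Proof.
apply: leq_trans (nbridges_gt0 d k) (leq_trans (nbridges_le_c_plus d k) _).
exact: c_plus_le_c_saw.
Qed.

Let c_saw_fekete d (l := limn (fun n => (c_saw d.+1 n)%:R `^ n%:R^-1) : R) :
  [/\ 1 <= l, forall n, l ^+ n <= (c_saw d.+1 n)%:R &
   forall e, 0 < e -> exists2 K, 0 < K &
     forall n, (c_saw d.+1 n)%:R <= K * (l + e) ^+ n].
Proof.
apply: (@fekete_submul R (fun n => (c_saw d.+1 n)%:R)) => [n|m n].
  by rewrite ler1n c_saw_gt0.
by rewrite -natrM ler_nat c_saw_submul.
Qed.

Lemma mu_ge1 d : 1 <= mu R d.+1.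
Proof. by rewrite /mu; case: eqP => // _; have [] := c_saw_fekete d. Qed.

Lemma mu_gt0 d : 0 < mu R d.+1.
Proof. exact: lt_le_trans (mu_ge1 d). Qed.

Lemma mu_exp_le_c_saw d n : mu R d.+1 ^+ n <= (c_saw d.+1 n)%:R.
Proof.
(* In dimension one [mu] is 1 by convention, and the claim is that a walk exists. *)
rewrite /mu; case: eqP => _; first by rewrite expr1n ler1n c_saw_gt0.
by have [] := c_saw_fekete d.
Qed.

Lemma c_saw_le_mu_exp d (e : R) : (0 < d)%N -> 0 < e -> exists2 K, 0 < K &
  forall n, (c_saw d.+1 n)%:R <= K * (mu R d.+1 + e) ^+ n.
Proof.
case: d => // d _ e0; rewrite /mu /=; have [_ _] := c_saw_fekete d.+1.
exact.
Qed.

(** Walks embed in the boundary of the next dimension, so their counts compare; a strict inequality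
    the other way would let one exponential overtake the other. *)
Lemma mu_le_succ d : mu R d.+1 <= mu R d.+2.
Proof.
apply/ler_addgt0Pr => e e0; rewrite leNgt; apply/negP => lt.
have [//|K K0 HK] := c_saw_le_mu_exp d.+1 e _ e0.
have [|n0 H] := expr_dominates _ _ K _ lt; first by have := mu_gt0 d.+1; lra.
have := H n0 (leqnn _); rewrite ltNge => /negP; apply.
apply: le_trans (mu_exp_le_c_saw _ _) (le_trans _ (HK n0)).
rewrite ler_nat; apply: leq_trans (c_saw_le_c_plus_all_visits _ _) _.
exact: c_plus_le_c_saw.
Qed.

(** * Unfolding, under the assumption that bridges grow no faster than [beta ^+ k] *)

Section Unfolding.
Context {d : nat}.
Local Notation S := ('I_d.+1 * bool)%type.
Variables (z beta : R).
Hypotheses (z0 : 0 < z) (beta0 : 0 < beta) (zb : z * beta < 1).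
Hypothesis nb_le : forall k, (0 < k)%N -> (nbridges d k)%:R <= beta ^+ k.

Let z0' : 0 <= z. Proof. exact: ltW. Qed.

Local Notation W N P := (@wgt S R N z (fun s => `[< P s >])).

(** By induction on the width: a walk reaching the top height splits into a bridge of that span and
    a walk in a thinner strip, so each span occurs at most once. A strip of width zero holds only
    the empty walk. *)
Lemma wgt_strip_walk N A : W N (strip_walk A) <=
  \prod_(j < A) (1 + W N (span_bridge j.+1)).
Proof.
elim: A => [|A IH].
  rewrite big_ord0 /wgt (big_pred1 ([bseq] : N.-bseq S)) // => s.
  apply/asboolP/eqP => [[_ h]|->]; last by split=> [|k /=]; [exact: saw_nil|lia].
  apply: val_inj; case: s h => -[|x s] sN //= h.
  by have := h 1%N => /(_ isT); lia.
rewrite big_ord_recr /= mulrDr mulr1.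
apply: le_trans (_ : W N (strip_walk A) +
    W N (span_bridge A.+1) * W N (strip_walk A) <= _); last first.
  by rewrite lerD // mulrC ler_wpM2r // wgt_ge0.
rewrite {1}/wgt (bigID (fun s : N.-bseq S => `[< strip_walk A s >])) /=.
rewrite lerD //.
  rewrite /wgt big_mkcond [leRHS]big_mkcond /= ler_sum // => s _.
  case: ifP => [/andP[_ ->]//|_]; case: ifP => // _; exact: exprn_ge0.
apply: (wgt_split _ _ (fun s => `[< strip_walk A.+1 s >] && ~~ `[< strip_walk A s >])
   _ _ (fun s1 s2 => s1 ++ reflect_walk s2) z0') => s sN /andP[/asboolP h /asboolPn h'].
have [s1 [s2 [? ? ? ?]]] := strip_walk_split A s h h'.
by exists s1, s2; split => //; apply/asboolP.
Qed.

(** A bridge has only one span, so the sum counts each nonempty bridge at most once; a geometric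
    series of ratio [z * beta] then bounds it. *)
Lemma sum_wgt_span_bridge N A :
  \sum_(j < A) W N (span_bridge j.+1) <= (1 - z * beta)^-1.
Proof.
pose P := fun s : seq S => `[< bridge s >] && (0 < size s)%N.
apply: le_trans (_ : @wgt S R N z P <= _).
  rewrite /wgt (exchange_big_dep (fun s : N.-bseq S => P s)) /=; last first.
    by move=> j s _ /asboolP[b s0 _]; rewrite /P s0 andbT; apply/asboolP.
  apply: ler_sum => s _; rewrite sumr_const -[leRHS]mulr1n.
  rewrite ler_wpMn2l ?exprn_ge0 //.
  apply/card_le1_eqP => i j /asboolP[_ _ hi] /asboolP[_ _ hj].
  by apply: val_inj; move: hi; rewrite hj => -[].
rewrite wgtE; apply: le_trans (_ : \sum_(n < N.+1) (z * beta) ^+ n <= _).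
  apply: ler_sum => -[[|k] kN] _ /=.
    rewrite /nwords eq_card0 ?mul0r ?expr0 // => s; rewrite !inE /P size_tuple.
    by rewrite andbF.
  rewrite exprMn mulrC ler_wpM2l ?exprn_ge0 //.
  apply: le_trans (nb_le k.+1 isT); rewrite ler_nat.
  by apply: nwords_le => s _ /andP[].
have zb1 : 0 < 1 - z * beta by rewrite subr_gt0.
rewrite -(ler_pM2l zb1) mulfV ?gt_eqF //.
rewrite -[1 - _]opprB mulNr -subrX1 opprB lerBlDr lerDl exprn_ge0 //.
by rewrite mulr_ge0 // ltW.
Qed.

Let E := expR (1 - z * beta)^-1.

(** From [1 + x <= expR x]. The bound depends on neither [N] nor [A], so the width may grow with the
    length. *)
Lemma wgt_strip_walk_bounded N A : W N (strip_walk A) <= E.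
Proof.
apply: le_trans (wgt_strip_walk N A) _.
apply: le_trans (_ : expR (\sum_(j < A) W N (span_bridge j.+1)) <= _); last first.
  by rewrite ler_expR sum_wgt_span_bridge.
elim: A => [|A IH]; first by rewrite !big_ord0 expR0.
rewrite !big_ord_recr /= expRD; apply: ler_pM => //; last exact: expR_ge1Dx.
  by apply: prodr_ge0 => j _; rewrite addr_ge0 // wgt_ge0.
by rewrite addr_ge0 // wgt_ge0.
Qed.

(** The factor [z] pays for the prepended up step, which [behead] removes again. *)
Lemma wgt_nonneg_walk N : W N nonneg_walk * z <= W N.+1 (strip_walk N.+1).
Proof.
rewrite /wgt mulr_suml.
apply: (ler_sum_surj _ _ _ _ _ _ (fun s : N.+1.-bseq S => insub_bseq N (behead s))).
  by move=> s _; rewrite exprn_ge0.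
move=> s /asboolP ns; have sN := size_bseq s.
exists (insub_bseq N.+1 (up_step :: s)); rewrite !val_insub_bseq //; split.
- apply/asboolP; have [ss sh] := strip_walk_up s ns; split => // k /sh /andP[-> h].
  by apply: le_trans h _; rewrite lez_nat ltnS.
- by apply: val_inj; rewrite /= val_insub_bseq.
- by rewrite /= exprSr.
Qed.

(** Both halves of a walk cut at its highest vertex have total weight at most [E / z], uniformly in
    [N]. *)
Lemma c_saw_bounded N : (c_saw d.+1 N)%:R * z ^+ N <= (E / z) ^+ 2.
Proof.
apply: le_trans (_ : @wgt S R N z (fun s => is_saw s) <= _).
  by apply: (wgt_ge N z (fun s => is_saw s) N z0').
apply: le_trans (_ : W N nonneg_walk * W N nonneg_walk <= _).
  apply: (wgt_split _ _ _ _ _ (fun s1 s2 => rev s1 ++ reflect_walk s2) z0').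
  move=> s sN /is_sawP/saw_split_at_max[s1 [s2 [? ? ? ?]]].
  by exists s1, s2; split => //; apply/asboolP.
rewrite -expr2 lerXn2r ?nnegrE ?wgt_ge0 ?divr_ge0 ?expR_ge0 //.
rewrite ler_pdivlMr //; apply: le_trans (wgt_nonneg_walk N) _.
exact: wgt_strip_walk_bounded.
Qed.

End Unfolding.

(* Hammersley and Welsh: bridges have the same growth constant as all walks. *)
Lemma exists_nbridges_gt d beta : 0 < beta -> beta < mu R d.+1 ->
  exists2 m, (0 < m)%N & beta ^+ m < (nbridges d m)%:R.
Proof.
move=> b0 bm; apply: contrapT => H.
have nb k : (0 < k)%N -> (nbridges d k)%:R <= beta ^+ k.
  by move=> k0; rewrite leNgt; apply/negP => lt; apply: H; exists k.
(* The reciprocal of the midpoint of [beta] and [mu], so that [z * beta < 1 < mu * z]. *)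
pose z := 2 / (beta + mu R d.+1).
have m0 := mu_gt0 d.
have s0 : 0 < beta + mu R d.+1 by lra.
have z0 : 0 < z by rewrite divr_gt0.
have zb : z * beta < 1 by rewrite /z mulrAC ltr_pdivrMr //; lra.
have zm : 1 < mu R d.+1 * z by rewrite mulrA ltr_pdivlMr //; lra.
have [n0 Hn] := expr_unbounded _ ((expR (1 - z * beta)^-1 / z) ^+ 2) zm.
have := Hn n0 (leqnn _); rewrite ltNge => /negP; apply.
apply: le_trans (c_saw_bounded z beta z0 b0 zb nb n0).
by rewrite exprMn ler_wpM2r ?exprn_ge0 ?(ltW z0) // mu_exp_le_c_saw.
Qed.

(** Supermultiplicativity spreads the single good length [m] to all lengths, through division by
    [m]. *)
Lemma nbridges_ge d beta : 0 < beta -> beta < mu R d.+1 ->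
  exists2 K, 0 < K & forall n, K * beta ^+ n <= (nbridges d n)%:R.
Proof.
move=> b0 bm; have [m m0 Hm] := exists_nbridges_gt d beta b0 bm.
have mulb q r : (nbridges d m ^ q <= nbridges d (q * m + r))%N.
  elim: q => [|q IH]; first by rewrite nbridges_gt0.
  rewrite expnS mulSn -addnA; apply: leq_trans (nbridges_supermul _ _ _).
  by rewrite leq_mul2l IH orbT.
(* This constant absorbs [beta ^+ r] for every remainder [r < m], on whichever side of 1 [beta]
   lies. *)
exists ((1 + beta) ^- m) => [|n]; first by rewrite invr_gt0 exprn_gt0 //; lra.
rewrite mulrC ler_pdivrMr ?exprn_gt0 //; last by lra.
rewrite {1}(divn_eq n m) exprD mulnC exprM; apply: ler_pM.
- by rewrite !exprn_ge0 // ltW.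
- by rewrite exprn_ge0 // ltW.
- apply: le_trans (_ : (nbridges d m)%:R ^+ (n %/ m) <= _).
    by rewrite lerXn2r ?nnegrE ?exprn_ge0 // ltW.
  by rewrite -natrX ler_nat {2}(divn_eq n m) mulb.
- apply: le_trans (_ : (1 + beta) ^+ (n %% m) <= _).
    by rewrite lerXn2r ?nnegrE; lra.
  by apply: ler_weXn2l; [lra|exact/ltnW/ltn_pmod].
Qed.

End GrowthConstant.

(** * Landau's inequality *)

Section Landau.
Context {C : numClosedFieldType}.
Implicit Types (p q : {poly C}) (z : C) (zs : seq C).

Definition sqnorm n p : C := \sum_(i < n) `|p`_i| ^+ 2.

Lemma normB_sqr (a b : C) : `|a - b| ^+ 2 =
  `|a| ^+ 2 + `|b| ^+ 2 - (a * b^* + a^* * b).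
Proof. by rewrite !normCK rmorphB; ring. Qed.

(* Exchanging a root [z] for its mirror image [1 / z^*] in the unit circle. *)
Lemma sqnorm_flip n q z : (size q <= n)%N ->
  sqnorm n.+1 (('X - z%:P) * q) = sqnorm n.+1 ((1 - z^* *: 'X) * q).
Proof.
move=> qn; pose a i := if i is j.+1 then q`_j else 0.
have e1 i : (('X - z%:P) * q)`_i = a i - z * q`_i.
  by rewrite mulrBl coefB coefXM coefCM; case: i.
have e2 i : ((1 - z^* *: 'X) * q)`_i = q`_i - z^* * a i.
  by rewrite mulrBl mul1r -scalerAl coefB coefZ coefXM; case: i.
apply/eqP; rewrite -subr_eq0 /sqnorm -sumrB.
(* The cross terms cancel coefficientwise. As [a] lists the coefficients of ['X * q], a shift of
   those of [q], the remaining sum vanishes. *)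
have -> : \sum_(i < n.+1) (`|(('X - z%:P) * q)`_i| ^+ 2 -
    `|((1 - z^* *: 'X) * q)`_i| ^+ 2) =
    (1 - `|z| ^+ 2) * \sum_(i < n.+1) (`|a i| ^+ 2 - `|q`_i| ^+ 2).
  rewrite mulr_sumr; apply: eq_bigr => i _; rewrite e1 e2 !normB_sqr.
  by rewrite !normrM norm_conjC !rmorphM /= conjCK; ring.
rewrite sumrB big_ord_recl /= normr0 expr0n /= add0r big_ord_recr /=.
by rewrite [q`_n]nth_default // normr0 expr0n /= addr0 subrr mulr0.
Qed.

(** Only roots inside the unit disc are flipped, so the constant term has modulus [max(1, |z|)]. *)
Definition flip_factor z : {poly C} :=
  if `|z| < 1 then 1 - z^* *: 'X else 'X - z%:P.

(** Here [q] accumulates the factors already flipped; the size bound keeps all coefficients within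
    the first [n]. *)
Lemma sqnorm_flip_prod n q zs : (size q + size zs <= n)%N ->
  sqnorm n (q * \prod_(z <- zs) ('X - z%:P)) =
  sqnorm n (q * \prod_(z <- zs) flip_factor z).
Proof.
elim: zs q => [|z zs IH] q; first by rewrite !big_nil.
case: n IH => [|n] IH /=; first by rewrite addnS.
rewrite addnS ltnS => qn; rewrite !big_cons.
have sq : (size (q * \prod_(z <- zs) ('X - z%:P))%R <= n)%N.
  apply: leq_trans qn; apply: leq_trans (size_polyMleq _ _) _.
  by rewrite size_prod_XsubC addnS.
transitivity (sqnorm n.+1 (q * flip_factor z * \prod_(z <- zs) ('X - z%:P))).
  rewrite mulrCA -mulrA (mulrCA q (flip_factor z)) /flip_factor.
  by case: ifP => // _; apply: sqnorm_flip.
have qn' : ((size q).+1 + size zs <= n.+1)%N by [].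
rewrite IH ?mulrA //; apply: leq_trans qn'.
rewrite leq_add2r; apply: leq_trans (size_polyMleq _ _) _.
suff : (size (flip_factor z) <= 2)%N by lia.
rewrite /flip_factor; case: ifP => _; last by rewrite size_XsubC.
apply: leq_trans (size_polyD _ _) _; rewrite geq_max size_polyN.
by rewrite size_poly1 /= (leq_trans (size_scale_leq _ _)) // size_polyX.
Qed.

Lemma sqnorm_ge_coef0 n p : (0 < n)%N -> `|p`_0| ^+ 2 <= sqnorm n p.
Proof.
case: n => // n _; rewrite /sqnorm big_ord_recl lerDl.
by apply: sumr_ge0 => i _; rewrite exprn_ge0.
Qed.

Lemma sum_sqr_le (n : nat) (F : nat -> C) : (forall i, 0 <= F i) ->
  \sum_(i < n) F i ^+ 2 <= (\sum_(i < n) F i) ^+ 2.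
Proof.
move=> F0; elim: n => [|n IH]; first by rewrite !big_ord0 expr0n.
rewrite !big_ord_recr /= sqrrD -addrA lerD // lerDr mulrn_wge0 // mulr_ge0 //.
by apply: sumr_ge0.
Qed.

Definition outer_norm z : C := if `|z| < 1 then 1 else `|z|.

(** The left side is the squared modulus of the constant term of the flipped polynomial, hence at
    most its squared l2 norm. Flipping preserves that norm, and the l1 norm dominates it. *)
Lemma landau_inequality n (c : C) zs (p := c *: \prod_(z <- zs) ('X - z%:P)) :
  (size zs < n)%N ->
  (`|c| * \prod_(z <- zs) outer_norm z) ^+ 2 <= (\sum_(i < n) `|p`_i|) ^+ 2.
Proof.
move=> zn; have n0 : (0 < n)%N by apply: leq_ltn_trans zn.
apply: le_trans (sum_sqr_le n (fun i => `|p`_i|) _) => //.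
rewrite -/(sqnorm n p) /p -mul_polyC sqnorm_flip_prod; last first.
  by rewrite size_polyC; case: (c != 0) => /=; lia.
apply: le_trans (sqnorm_ge_coef0 _ _ n0).
rewrite -!horner_coef0 hornerM hornerC normrM horner_prod normr_prod.
rewrite le_eqVlt; apply/orP; left; apply/eqP; congr ((_ * _) ^+ 2).
apply: eq_bigr => z _; rewrite /outer_norm /flip_factor; case: ifP => _.
  by rewrite hornerD hornerN hornerZ hornerX hornerC mulr0 subr0 normr1.
by rewrite hornerXsubC sub0r normrN.
Qed.

(** Since [|p_0|] is [|c|] times the product of the [|z|], it suffices that each zero satisfies
    [|z| <= outer_norm z ^+ 2], with an extra factor [r] on the left when it lies outside. *)
Lemma count_zeros_outside_annulus n (c r : C) zs
    (p := c *: \prod_(z <- zs) ('X - z%:P)) :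
  1 <= r -> (size zs < n)%N ->
  r ^+ count (fun z => ~~ ((r^-1 < `|z|) && (`|z| < r))) zs * (`|c| * `|p`_0|)
    <= (\sum_(i < n) `|p`_i|) ^+ 2.
Proof.
move=> r1 zn; apply: le_trans (landau_inequality n c zs zn).
have r0 : 0 < r by apply: lt_le_trans r1.
rewrite /p coefZ normrM [`|c| * (_ * _)]mulrA -expr2 mulrCA exprMn ler_wpM2l ?exprn_ge0 //.
rewrite -horner_coef0 horner_prod normr_prod.
elim: zs {p zn} => [|z zs IH]; first by rewrite !big_nil expr1n mulr1.
rewrite !big_cons /= exprD mulrACA exprMn.
apply: ler_pM => //; try by rewrite mulr_ge0 ?exprn_ge0 ?prodr_ge0 // ltW.
rewrite hornerXsubC sub0r normrN /outer_norm.
have rz : `|z| \is Num.real by apply: normr_real.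
have rr : r \is Num.real by rewrite ger0_real // ltW.
have rV : r^-1 \is Num.real by rewrite rpredV.
case: (real_ltP rz (real1 C)) => z1.
  rewrite expr1n; have -> : `|z| < r by apply: lt_le_trans r1.
  case: (real_ltP rV rz) => zr /=; first by rewrite mul1r ltW.
  by rewrite expr1 -(mulfV (lt0r_neq0 r0)) ler_wpM2l // ltW.
rewrite expr2 ler_wpM2r //.
case: (real_ltP rV rz); case: (real_ltP rz rr) => //= zr Vz.
(* The case left is contradictory: [1 <= |z| <= r^-1] forces [r <= 1 <= |z|], against [|z| < r]. *)
rewrite -(lt_geF zr); apply: (le_trans _ z1).
rewrite -(mulfV (lt0r_neq0 r0)) ler_peMr ?(ltW r0) //.
by apply: (le_trans _ Vz).
Qed.

End Landau.

(** * Zeros of the partition function *)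

Section PartitionFunction.
Context (R : realType) (d : nat) (t : R).
Hypothesis t0 : 0 < t.
Local Notation dim := d.+2.
Local Open Scope complex_scope.

(** The coefficient of [a^v] in [G], kept real; the test reflects that [Aplus] stops at [v = n]. *)
Definition gcoef N v : R :=
  \sum_(n < N.+1) t ^+ n * (if (v < n.+1)%N then c_plus dim n v else 0%N)%:R.

Lemma coefG N v : (G R dim N t)`_v = (gcoef N v)%:C.
Proof.
rewrite /G coef_sum rmorph_sum; apply: eq_bigr => n _.
rewrite coefZ /Aplus -(poly_def n.+1 (fun v => (c_plus dim n v)%:R)) coef_poly.
rewrite rmorphM rmorph_nat.
by case: ifP.
Qed.

Lemma gcoef_ge0 N v : 0 <= gcoef N v.
Proof. by apply: sumr_ge0 => n _; rewrite mulr_ge0 // exprn_ge0 // ltW. Qed.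

Lemma norm_coefG N v : `|(G R dim N t)`_v| = (gcoef N v)%:C.
Proof. by rewrite coefG ger0_norm // ler0c gcoef_ge0. Qed.

Lemma gcoef_top N : gcoef N N = t ^+ N * (c_plus dim N N)%:R.
Proof.
rewrite /gcoef big_ord_recr /= ltnSn big1 ?add0r // => n _.
by rewrite ltnS leqNgt ltn_ord mulr0.
Qed.

Lemma gcoef0_ge N : t ^+ N * (c_plus dim N 0)%:R <= gcoef N 0.
Proof.
rewrite /gcoef big_ord_recr /= lerDr.
by apply: sumr_ge0 => n _; rewrite mulr_ge0 // exprn_ge0 // ltW.
Qed.

Lemma sum_gcoef_le N :
  \sum_(v < N.+1) gcoef N v <= \sum_(n < N.+1) t ^+ n * (c_saw dim n)%:R.
Proof.
rewrite exchange_big /=; apply: ler_sum => n _.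
rewrite -mulr_sumr ler_wpM2l ?exprn_ge0 ?(ltW t0) //.
rewrite -natr_sum ler_nat -big_mkcond /=.
rewrite -(big_ord_widen N.+1 (fun v => c_plus dim n v)) //.
exact: sum_c_plus_le_c_saw.
Qed.

Lemma gcoef_top_ge N : (t * mu R d.+1) ^+ N <= gcoef N N.
Proof.
rewrite gcoef_top exprMn ler_wpM2l ?exprn_ge0 ?(ltW t0) //.
apply: le_trans (mu_exp_le_c_saw _ _ _) _.
by rewrite ler_nat c_saw_le_c_plus_all_visits.
Qed.

Lemma gcoef_top_gt0 N : 0 < gcoef N N.
Proof.
by apply: lt_le_trans (gcoef_top_ge N); rewrite exprn_gt0 // mulr_gt0 // mu_gt0.
Qed.

(** The top coefficient is positive, so the degree is exactly [N]; this is what makes the number of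
    zeros equal to [N]. *)
Lemma size_G N : size (G R dim N t) = N.+1.
Proof.
apply/eqP; rewrite eqn_leq; apply/andP; split; last first.
  rewrite ltnNge; apply/negP => /leq_sizeP/(_ N (leqnn N))/eqP.
  rewrite coefG -(rmorph0 (real_complex R)) (inj_eq (@complexI R)).
  by rewrite gt_eqF // gcoef_top_gt0.
apply/leq_sizeP => j Nj; rewrite coefG /gcoef big1 ?rmorph0 // => n _.
by rewrite ltnNge (leq_trans (ltn_ord n)) // mulr0.
Qed.

Lemma G_zerosE N : G R dim N t =
  (gcoef N N)%:C *: \prod_(z <- zeros R (G R dim N t)) ('X - z%:P).
Proof.
rewrite [LHS](svalP (closed_field_poly_normal (G R dim N t))) -/(zeros R _).
by rewrite lead_coefE size_G coefG.
Qed.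

Lemma size_zeros N : size (zeros R (G R dim N t)) = N.
Proof.
have c0 : (gcoef N N)%:C != 0.
  rewrite -(rmorph0 (real_complex R)) (inj_eq (@complexI R)).
  by rewrite gt_eqF // gcoef_top_gt0.
have := size_G N; rewrite {1}G_zerosE size_scale //.
by rewrite (size_prod_XsubC _ id) => -[].
Qed.

Lemma nu_open_le_nu N rho : (nu_open R dim N t rho <= nu R dim N t rho)%N.
Proof. by apply: sub_count => z /andP[/ltW -> /ltW ->]. Qed.

Lemma nu_le N rho : (nu R dim N t rho <= N)%N.
Proof. by rewrite -[leqRHS](size_zeros N) count_size. Qed.

Lemma zeros_outside_annulus N rho : 0 <= rho < 1 ->
  (1 - rho)^-1 ^+ (N - nu_open R dim N t rho) * (gcoef N N * gcoef N 0) <=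
  (\sum_(v < N.+1) gcoef N v) ^+ 2.
Proof.
move=> /andP[r0 r1]; pose zs := zeros R (G R dim N t).
have eS : \sum_(v < N.+1) `|(G R dim N t)`_v| = (\sum_(v < N.+1) gcoef N v)%:C.
  by rewrite rmorph_sum; apply: eq_bigr => v _; rewrite norm_coefG.
have eN : `|(gcoef N N)%:C : R[i]| = (gcoef N N)%:C.
  by rewrite ger0_norm // ler0c gcoef_ge0.
have -> : (N - nu_open R dim N t rho)%N =
    count (fun z => ~~ (((1 - rho)^-1%:C)^-1 < `|z| < (1 - rho)^-1%:C)) zs.
  rewrite -{1}(size_zeros N).
  rewrite -(count_predC (fun z => (1 - rho)%:C < `|z| < ((1 - rho)^-1)%:C)).
  rewrite /nu_open addKn; apply: eq_count => z /=.
  by rewrite -fmorphV invrK.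
have := @count_zeros_outside_annulus R[i] N.+1 (gcoef N N)%:C ((1 - rho)^-1)%:C zs.
rewrite /= -G_zerosE eS norm_coefG eN -[in X in _ -> X]lecR !rmorphM !rmorphXn /=.
apply; last by rewrite size_zeros.
by rewrite -(rmorph1 (real_complex R)) lecR invf_ge1; lra.
Qed.

Hypothesis tmu : 1 < t * mu R dim.

Lemma zeta_ge0 : 0 <= zeta R dim.
Proof.
rewrite /zeta /= ln_ge0 // ler_pdivlMr ?mu_gt0 // mul1r; exact: mu_le_succ.
Qed.

(** Since [t * mu] exceeds 1, the geometric sum is comparable to its last term. *)
Lemma sum_c_saw_le (e : R) : 0 < e -> exists2 K, 0 < K & forall N,
  \sum_(n < N.+1) t ^+ n * (c_saw dim n)%:R <= K * (t * mu R dim * expR e) ^+ N.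
Proof.
move=> e0; pose x := t * mu R dim * expR e.
have e1 : 1 < expR e by rewrite expR_gt1.
have m0 := @mu_gt0 R d.+1.
have x1 : 1 < x by apply: lt_trans tmu _; rewrite ltr_pMr // mulr_gt0.
(* The error is chosen so that adding it to [mu R dim] gives [mu R dim * expR e]. *)
have [||K K0 HK] := c_saw_le_mu_exp R d.+1 (mu R dim * (expR e - 1)) => //.
  by rewrite mulr_gt0 // subr_gt0.
have xx : 0 < x - 1 by lra.
exists (K * (x / (x - 1))) => [|N]; first by rewrite mulr_gt0 // divr_gt0 //; lra.
apply: le_trans (_ : K * \sum_(n < N.+1) x ^+ n <= _).
  rewrite mulr_sumr; apply: ler_sum => n _.
  rewrite /x -mulrA exprMn mulrCA ler_wpM2l ?exprn_ge0 ?(ltW t0) //.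
  by apply: le_trans (HK n) _; rewrite mulrBr mulr1 addrC subrK.
rewrite -mulrA ler_wpM2l ?(ltW K0) // mulrAC -exprS ler_pdivlMr // mulrC -subrX1.
by rewrite lerBlDr lerDl.
Qed.

Lemma gcoef0_ge_exp (e : R) : 0 < e -> exists2 K, 0 < K & forall N,
  K * (t * mu R dim * expR (- e)) ^+ N <= gcoef N 0.
Proof.
move=> e0; have m0 := @mu_gt0 R d.+1.
have [||K K0 HK] := nbridges_ge R d.+1 (mu R dim * expR (- e)).
- by rewrite mulr_gt0 // expR_gt0.
- by rewrite gtr_pMr // expR_lt1 oppr_lt0.
exists K => // N; apply: le_trans (gcoef0_ge N).
rewrite -mulrA exprMn mulrCA ler_wpM2l ?exprn_ge0 ?(ltW t0) //.
by apply: le_trans (HK N) _; rewrite ler_nat nbridges_le_c_plus.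
Qed.

Lemma outside_annulus_le rho (e : R) : 0 < rho < 1 -> 0 < e ->
  exists C, forall N,
    (N - nu_open R dim N t rho)%:R * rho <= C + N%:R * (zeta R dim + 3 * e).
Proof.
move=> /andP[r0 r1] e0.
have [K1 K10 H1] := sum_c_saw_le e e0.
have [K2 K20 H2] := gcoef0_ge_exp e e0.
exists (ln (K1 ^+ 2 / K2)) => N.
set k := (N - _)%N.
have m0 := @mu_gt0 R d.+1; have m0' := @mu_gt0 R d.
have tm : 0 < t * mu R d.+1 by rewrite mulr_gt0.
have tm' : 0 < t * mu R dim by rewrite mulr_gt0.
have r1' : 0 < 1 - rho by lra.
(* The powers of [t] cancel and the growth constants leave [mu_d / mu_(d-1)], the exponential of
   [zeta]. The slack [e] counts twice from the squared sum and once from the constant coefficient,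
   whence [3 * e]. *)
have key : (1 - rho)^-1 ^+ k <= K1 ^+ 2 / K2 * expR (zeta R dim + 3 * e) ^+ N.
  pose D := (t * mu R d.+1) ^+ N * (K2 * (t * mu R dim * expR (- e)) ^+ N).
  have D0 : 0 < D by rewrite !mulr_gt0 // exprn_gt0 // mulr_gt0 // expR_gt0.
  have -> : K1 ^+ 2 / K2 * expR (zeta R dim + 3 * e) ^+ N =
      (K1 * (t * mu R dim * expR e) ^+ N) ^+ 2 / D.
    have -> : expR (zeta R dim + 3 * e) = (t * mu R dim * expR e) ^+ 2 /
        (t * mu R d.+1 * (t * mu R dim * expR (- e))).
      rewrite expRD /zeta lnK ?posrE ?divr_gt0 // expRN.
      have -> : 3 * e = e + e + e by lra.
      rewrite !expRD /=; have := expR_gt0 e => ee.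
      by field; rewrite !gt_eqF.
    have p0 := exprn_gt0 N tm.
    have p1 : 0 < (t * mu R dim * expR (- e)) ^+ N.
      by rewrite exprn_gt0 // mulr_gt0 // expR_gt0.
    rewrite /D expr_div_n exprAC [(t * mu R d.+1 * _) ^+ N]exprMn.
    move: p0 p1; move: (_ ^+ N) (_ ^+ N) (_ ^+ N) => A B X A0 B0.
    by field; rewrite !gt_eqF.
  rewrite ler_pdivlMr //.
  apply: le_trans (_ : (1 - rho)^-1 ^+ k * (gcoef N N * gcoef N 0) <= _).
    rewrite ler_wpM2l ?exprn_ge0 ?invr_ge0 ?(ltW r1') //.
    apply: ler_pM => //; first by rewrite exprn_ge0 // ltW.
      by rewrite mulr_ge0 ?(ltW K20) // exprn_ge0 // mulr_ge0 ?expR_ge0 // ltW.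
    exact: gcoef_top_ge.
  apply: le_trans (zeros_outside_annulus N rho _) _; first by rewrite (ltW r0).
  rewrite lerXn2r ?nnegrE //.
  - by apply: sumr_ge0 => v _; apply: gcoef_ge0.
  - by rewrite mulr_ge0 ?(ltW K10) // exprn_ge0 // mulr_ge0 ?expR_ge0 // ltW.
  - exact: le_trans (sum_gcoef_le N) (H1 N).
have K0 : 0 < K1 ^+ 2 / K2 by rewrite divr_gt0 // exprn_gt0.
have := key; rewrite -ler_ln ?posrE; last 2 first.
- by rewrite exprn_gt0 // invr_gt0.
- by rewrite mulr_gt0 // exprn_gt0 // expR_gt0.
rewrite lnM ?posrE ?exprn_gt0 ?expR_gt0 // !lnXn ?expR_gt0 ?invr_gt0 // expRK.
rewrite !mulr_natl => H; apply: le_trans H.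
rewrite lerMn2r lnV ?posrE // lerNr; apply/orP; right.
(* From [1 - rho <= expR (- rho)], each zero outside contributes at least [rho] to the logarithm. *)
have := expR_ge1Dx (- rho); rewrite -[leLHS]lnK ?posrE //.
by rewrite ler_expR.
Qed.

End PartitionFunction.

(** * Lower and upper limits of eventually bounded sequences *)

Section EventualBounds.
Context {R : realType}.
Local Open Scope ereal_scope.
Implicit Types (u : nat -> \bar R) (a : \bar R).

Lemma limn_einf_ge u a n0 : (forall n, (n0 <= n)%N -> a <= u n) -> a <= limn_einf u.
Proof.
move=> H; rewrite limn_einf_lim; apply: lime_ge; first exact: is_cvg_einfs.
exists n0 => // n /= n0n; apply: le_ereal_inf_tmp => _ [m /= nm <-].
by apply: H; apply: leq_trans nm.
Qed.

Lemma limn_esup_le u a : (forall n, u n <= a) -> limn_esup u <= a.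
Proof.
move=> H; rewrite limn_esup_lim; apply: lime_le; first exact: is_cvg_esups.
by apply: nearW => n; apply: ge_ereal_sup => _ [m _ <-].
Qed.

End EventualBounds.

Theorem theorem2p10 (R : realType) (d : nat) (t rho : R) :
  (2 <= d)%N -> (mu R d)^-1 < t -> zeta R d < rho < 1 ->
  [/\ 0 < 1 - rho^-1 * zeta R d,
      ((1 - rho^-1 * zeta R d)%:E <=
         limn_einf (fun N : nat => ((nu R d N t rho)%:R / N%:R : R)%:E))%E,
      (limn_einf (fun N : nat => ((nu R d N t rho)%:R / N%:R : R)%:E) <=
         limn_esup (fun N : nat => ((nu R d N t rho)%:R / N%:R : R)%:E))%E,
      (limn_esup (fun N : nat => ((nu R d N t rho)%:R / N%:R : R)%:E) <= 1%:E)%E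
    & (0%:E < limn_einf (fun N : nat => ((nu_open R d N t rho)%:R / N%:R : R)%:E))%E].
Proof.
case: d => [|[|d]] // _ tmu /andP[zr r1].
have mu0 := mu_gt0 R d.+1.
have t0 : 0 < t by apply: lt_trans tmu; rewrite invr_gt0.
have tmu1 : 1 < t * mu R d.+2 by rewrite -ltr_pdivrMr // mul1r.
have z0 := zeta_ge0 R d.
have r0 : 0 < rho by apply: le_lt_trans zr.
have frac_gt0 : 0 < 1 - rho^-1 * zeta R d.+2.
  by rewrite subr_gt0 mulrC ltr_pdivrMr // mul1r.
(* Bounding the count in the open annulus serves both lower limits, since the closed annulus
   contains at least as many zeros. *)
have nu_open_ge (e : R) : 0 < e -> exists n0, forall N, (n0 <= N)%N ->
    1 - rho^-1 * zeta R d.+2 - e <= (nu_open R d.+2 N t rho)%:R / N%:R.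
  (* Then [3 * e' / rho] is half of [e]; the other half absorbs the constant [C] divided by
     [N * rho]. *)
  move=> e0; pose e' := e * rho / 6.
  have e'0 : 0 < e' by rewrite !mulr_gt0 // invr_gt0.
  have [||C HC] := outside_annulus_le R d t t0 tmu1 rho e' => //.
    by rewrite r0.
  exists (Num.bound `|2 * C / (e * rho)|).+1 => N NB.
  have N0 : 0 < N%:R :> R by rewrite ltr0n; apply: leq_trans NB.
  have er0 : 0 < e * rho by rewrite mulr_gt0.
  have CN : 2 * C <= N%:R * (e * rho).
    rewrite -ler_pdivrMr //; apply: le_trans (ler_norm _) _.
    apply: le_trans (ltW (archi_boundP (normr_ge0 _))) _.
    by rewrite ler_nat ltnW.
  have nuN : (nu_open R d.+2 N t rho <= N)%N.
    by apply: leq_trans (nu_open_le_nu _ _ _ _ _) (nu_le _ _ _ t0 _ _).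
  have := HC N; rewrite natrB // => H.
  rewrite ler_pdivlMr // -(ler_pM2r r0).
  have -> : (1 - rho^-1 * zeta R d.+2 - e) * N%:R * rho =
     N%:R * rho - N%:R * zeta R d.+2 - N%:R * (e * rho).
    by field; rewrite gt_eqF.
  have ee : N%:R * (zeta R d.+2 + 3 * e') =
      N%:R * zeta R d.+2 + N%:R * (e * rho) / 2 by rewrite /e'; field.
  by rewrite ee in H; lra.
have einf_open : ((1 - rho^-1 * zeta R d.+2)%:E <=
    limn_einf (fun N : nat => ((nu_open R d.+2 N t rho)%:R / N%:R : R)%:E))%E.
  apply/lee_addgt0Pr => e e0; have [n0 H] := nu_open_ge e e0.
  rewrite -leeBlDr // -EFinB; apply: (limn_einf_ge _ _ n0) => N /H.
  by rewrite lee_fin.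
split => //.
- apply/lee_addgt0Pr => e e0; have [n0 H] := nu_open_ge e e0.
  rewrite -leeBlDr // -EFinB; apply: (limn_einf_ge _ _ n0) => N /H.
  rewrite lee_fin => /le_trans; apply.
  by rewrite ler_wpM2r ?invr_ge0 // ler_nat nu_open_le_nu.
- exact: limn_einf_sup.
- apply: limn_esup_le => N; rewrite lee_fin.
  (* At [N = 0] the quotient is 0, as division by zero returns 0. *)
  case: (posnP N) => [->|N0]; first by rewrite invr0 mulr0.
  by rewrite ler_pdivrMr ?ltr0n // mul1r ler_nat nu_le.
- by apply: lt_le_trans einf_open; rewrite lte_fin.
Qed.
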